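(* Let $X$ be the Fermat quintic threefold, $L$ its real points, $g\in G$, $\gamma=e^{2\pi i/5}$, and let $u_0:S_0\to X$ be a finite-energy holomorphic strip mapping the ray $\mathbb R_{\ge0}$ into $L$ and the ray $e^{2\pi i/10}\mathbb R_{\ge0}$ into $gL$. Let $u:\mathbb{CP}^1=\mathbb C\cup\{\infty\}\to X$ be the holomorphic sphere obtained from $u_0$ by reflection. Then $u$ has the following symmetries: (1) $u(z)=\overline{u(\bar z)}$, and (2) $u(\gamma z)=g^2u(z)$.
   Context: $X=\{X_0^5+\cdots+X_4^5=0\}\subset\mathbb{CP}^4$; the bar on points of $X$ is complex conjugation of homogeneous coordinates; $L=\{[X_0:\dots:X_4]\in X:X_i\in\mathbb R\}$; $G$ is the group of automorphisms of $X$ multiplying homogeneous coordinates by fifth roots of unity. Let $\sigma=e^{2\pi i/10}$ and $S_0\subset\mathbb C$ be the sector bounded by the rays $\mathbb R_{\ge0}$ and $\sigma\mathbb R_{\ge0}$ (vertex removed), biholomorphic to the strip $\mathbb R\times[0,1]$ via $z\mapsto e^{\pi z/5}$. Reflection: put $S_k=\sigma^kS_0$ and for $1\le k\le9$ define $u_k:S_k\to X$ by $$u_k(z)=\begin{cases}g^{k+1}\overline{u_0(\sigma^{k+1}\bar z)}&k\text{ odd},\\ g^ku_0(\sigma^{-k}z)&k\text{ even}.\end{cases}$$ The maps $u_0,\dots,u_9$ agree on overlaps and glue to a holomorphic map $\mathbb C\setminus\{0\}\to X$, which, by finiteness of the energy of $u_0$, extends to a holomorphic map $u:\mathbb{CP}^1\to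 X$. *)

(* Defs.v *)
From HB Require Import structures.
From mathcomp Require Import all_boot all_order all_algebra.
From mathcomp Require Import complex.
From mathcomp Require Import all_classical all_reals all_analysis.

Set Implicit Arguments.
Unset Strict Implicit.
Unset Printing Implicit Defensive.

Import Order.TTheory GRing.Theory Num.Theory.
Import numFieldNormedType.Exports.

Local Open Scope classical_set_scope.
Local Open Scope ring_scope.
Local Open Scope complex_scope.
Local Open Scope quotient_scope.

(* Projective n-space over a field: nonzero vectors of F^(n+1) modulo equality
   of the lines they span. *)
Section ProjectiveSpace.
Variables (F : fieldType) (n : nat).

Definition nzvec : Type := {v : 'rV[F]_n.+1 | v != 0}.

Definition same_line (v w : nzvec) : bool := (val v == val w)%MS.

Lemma same_line_refl : reflexive same_line.
Proof. by move=> v; rewrite /same_line; apply/eqmxP. Qed.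

Lemma same_line_sym : symmetric same_line.
Proof. by move=> v w; rewrite /same_line andbC. Qed.

Lemma same_line_trans : transitive same_line.
Proof.
move=> w v x; rewrite /same_line => /eqmxP vw /eqmxP wx.
by apply/eqmxP; apply: eqmx_trans vw wx.
Qed.

Canonical same_line_equiv :=
  EquivRel same_line same_line_refl same_line_sym same_line_trans.

Definition proj : Type := {eq_quot same_line_equiv}.
HB.instance Definition _ := Choice.on proj.
HB.instance Definition _ := EqQuotient.on proj.

Lemma delta_neq0 : delta_mx 0 0 != 0 :> 'rV[F]_n.+1.
Proof.
by apply/eqP => /matrixP/(_ 0 0)/eqP; rewrite !mxE !eqxx /= oner_eq0.
Qed.

(* The point with homogeneous coordinates v, for v != 0; the value at v = 0
   is arbitrary. *)
Definition point (v : 'rV[F]_n.+1) : proj :=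
  \pi_proj (insubd (Sub (delta_mx 0 0) delta_neq0 : nzvec) v).

(* A choice of homogeneous coordinates of p. *)
Definition hom (p : proj) : 'rV[F]_n.+1 := val (repr p).

Lemma hom_neq0 p : hom p != 0.
Proof. exact: (valP (repr p)). Qed.

Lemma homK : cancel hom point.
Proof. by move=> p; rewrite /point /hom valKd reprK. Qed.

Lemma eq_point v w : v != 0 -> w != 0 -> (point v = point w) <-> (v == w)%MS.
Proof.
move=> v0 w0; split=> [/eqmodP|vw].
  by rewrite /= /same_line !insubdK.
by apply/eqmodP; rewrite /= /same_line !insubdK.
Qed.

Lemma pointZ (c : F) v : c != 0 -> point (c *: v) = point v.
Proof.
move=> c0; have [->|v0] := eqVneq v 0; first by rewrite scaler0.
apply/eq_point => //; first by rewrite scaler_eq0 negb_or c0.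
by apply/eqmxP/eqmx_scale.
Qed.

Lemma hom_point v : v != 0 -> exists2 c, c != 0 & hom (point v) = c *: v.
Proof.
move=> v0; have : point (hom (point v)) = point v by rewrite homK.
move/(eq_point (hom_neq0 _) v0)/andP => [/sub_rVP[c e] _]; exists c => //.
by apply: contraNneq (hom_neq0 (point v)) => c0; rewrite e c0 scale0r.
Qed.

(* Standard affine charts: the i-th chart is p |-> (X_j / X_i)_j on X_i != 0. *)
Definition chart_dom (i : 'I_n.+1) (p : proj) : bool := hom p 0 i != 0.
Definition chart (i : 'I_n.+1) (p : proj) : 'rV[F]_n.+1 :=
  \row_j (hom p 0 j / hom p 0 i).

(* [X_0 : ... : X_n] |-> [d_0 X_0 : ... : d_n X_n]; meaningful when all d_j
   are nonzero. *)
Definition pdiag (d : 'rV[F]_n.+1) (p : proj) : proj :=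
  point (\row_j (d 0 j * hom p 0 j)).

Lemma scale_row_neq0 (d v : 'rV[F]_n.+1) :
  (forall j, d 0 j != 0) -> v != 0 -> \row_j (d 0 j * v 0 j) != 0.
Proof.
move=> d0; apply: contra => /eqP/rowP h; apply/eqP/rowP => j.
by have /eqP := h j; rewrite !mxE mulf_eq0 (negbTE (d0 j)) => /eqP.
Qed.

Lemma pdiag_point (d v : 'rV[F]_n.+1) : (forall j, d 0 j != 0) -> v != 0 ->
  pdiag d (point v) = point (\row_j (d 0 j * v 0 j)).
Proof.
move=> d0 v0; rewrite /pdiag; have [c c0 ->] := hom_point v0.
rewrite -[RHS](pointZ _ c0); congr point; apply/rowP => j.
by rewrite !mxE mulrCA.
Qed.

End ProjectiveSpace.

Notation CP R n := (proj (complex R) n).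

Section ComplexGeometry.
Variable R : realType.
Local Notation C := (R[i]^o).

Definition pconj n (p : CP R n) : CP R n := point (map_mx (@conjc R) (hom p)).

Lemma conj_neq0 n (v : 'rV[R[i]]_n) : v != 0 -> map_mx (@conjc R) v != 0.
Proof. by rewrite map_mx_eq0. Qed.

Lemma pconj_point n (v : 'rV[R[i]]_n.+1) : v != 0 ->
  pconj (point v) = point (map_mx (@conjc R) v).
Proof.
move=> v0; rewrite /pconj; have [c c0 ->] := hom_point v0.
by rewrite map_mxZ pointZ // fmorph_eq0.
Qed.

(* Continuity on D and holomorphy on an open U, read in the affine charts. *)
Definition continuous_onCP n (D : set C) (f : C -> CP R n) : Prop :=
  forall z, D z -> forall i, chart_dom i (f z) ->
    (\forall w \near within D (nbhs z), chart_dom i (f w)) /\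
    forall j, (fun w => chart i (f w) 0 j : C) @ within D (nbhs z)
                --> (chart i (f z) 0 j : C).

Definition holomorphic_onCP n (U : set C) (f : C -> CP R n) : Prop :=
  forall z, U z -> forall i, chart_dom i (f z) ->
    (\forall w \near nbhs z, chart_dom i (f w)) /\
    forall j, derivable (fun w : C => chart i (f w) 0 j : C) z 1.

(* CP^1 as C together with infinity: z |-> [z : 1] and infinity = [1 : 0];
   w |-> [1 : w] parametrizes a neighbourhood of infinity. *)
Definition row2 (a b : R[i]) : 'rV[R[i]]_2 := \row_j (if j == 0 then a else b).
Definition ofC (z : C) : CP R 1 := point (row2 z 1).
Definition ofC_inf (w : C) : CP R 1 := point (row2 1 w).
Definition infty : CP R 1 := point (row2 1 0).

(* Multiplication by a != 0 on CP^1, [X_0 : X_1] |-> [a X_0 : X_1]. *)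
Definition cmul (a : R[i]) (p : CP R 1) : CP R 1 := pdiag (row2 a 1) p.

Definition holomorphic_sphere n (f : CP R 1 -> CP R n) : Prop :=
  holomorphic_onCP setT (f \o ofC) /\ holomorphic_onCP setT (f \o ofC_inf).

Lemma row2_neq0 a b : (a != 0) || (b != 0) -> row2 a b != 0.
Proof.
by move=> ab; apply/eqP => /rowP h; move: ab (h 0) (h 1); rewrite !mxE /=;
  case/orP => /eqP.
Qed.

Lemma cmul_ofC a z : a != 0 -> cmul a (ofC z) = ofC (a * z).
Proof.
move=> a0; rewrite /cmul /ofC pdiag_point ?row2_neq0 ?oner_eq0 ?orbT //.
  by congr point; apply/rowP => j; rewrite !mxE; case: ifP; rewrite ?mulr1.
by move=> j; rewrite mxE; case: ifP => // _; rewrite oner_eq0.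
Qed.

Lemma cmul_infty a : a != 0 -> cmul a infty = infty.
Proof.
move=> a0; rewrite /cmul /infty pdiag_point ?row2_neq0 ?oner_eq0 //.
  rewrite -[RHS](pointZ _ a0); congr point; apply/rowP => j.
  by rewrite !mxE; case: ifP; rewrite ?mulr1 ?mulr0.
by move=> j; rewrite mxE; case: ifP => // _; rewrite oner_eq0.
Qed.

Lemma pconj_ofC z : pconj (ofC z) = ofC (conjc z).
Proof.
rewrite /ofC pconj_point ?row2_neq0 ?oner_eq0 ?orbT //; congr point.
by apply/rowP => j; rewrite !mxE; case: ifP; rewrite ?rmorph1.
Qed.

Lemma pconj_infty : pconj infty = infty.
Proof.
rewrite /infty pconj_point ?row2_neq0 ?oner_eq0 //; congr point.
by apply/rowP => j; rewrite !mxE; case: ifP; rewrite ?rmorph1 ?rmorph0.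
Qed.

(* Fubini-Study energy density |df/dz|^2 of a holomorphic f at z, computed from
   the local lift v = chart i \o f :
   (|v|^2 |v'|^2 - |<v', v>|^2) / |v|^4, independent of the lift. *)
Definition herm m (v w : 'rV[R[i]]_m) : R[i] := \sum_j v 0 j * conjc (w 0 j).

Definition fubini_study m (v v' : 'rV[R[i]]_m) : R :=
  complex.Re ((herm v v * herm v' v' - herm v' v * herm v v') / herm v v ^+ 2).

Definition chart_at n (p : CP R n) : 'I_n.+1 :=
  odflt 0 [pick i | chart_dom i p].

Definition energy_density n (f : C -> CP R n) (z : C) : R :=
  let i := chart_at (f z) in
  fubini_study (chart i (f z))
    (\row_j ('D_(1 : C) (fun w : C => chart i (f w) 0 j : C) z)).

Definition energy n (U : set C) (f : C -> CP R n) : \bar R :=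
  (\int[lebesgue_measure \x lebesgue_measure]_(p in
      [set p : R * R | U ((p.1 +i* p.2) : C)])
     (energy_density f ((p.1 +i* p.2) : C))%:E)%E.

Definition expi (t : R) : R[i] := cos t +i* sin t.
Definition sigma : R[i] := expi (2 * pi / 10).
Definition gamma : R[i] := expi (2 * pi / 5).

(* The image of the strip {s + i t | 0 <= t <= 1} under z |-> e^(pi z / 5),
   with r = e^(pi s / 5). *)
Definition sector0 : set C :=
  [set z | exists r t : R,
     [/\ 0 < r, 0 <= t <= 1 & z = r%:C * expi (pi * t / 5)]].
Definition sector (k : nat) : set C := [set sigma ^+ k * z | z in sector0].

Definition fermat (p : CP R 4) : bool := \sum_j hom p 0 j ^+ 5 == 0.

Definition X : Type := {p : CP R 4 | fermat p}.

Lemma fermat_point (v : 'rV[R[i]]_5) : v != 0 ->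
  fermat (point v) = (\sum_j v 0 j ^+ 5 == 0).
Proof.
move=> v0; rewrite /fermat; have [c c0 ->] := hom_point v0.
under eq_bigr do rewrite mxE exprMn.
by rewrite -mulr_sumr mulf_eq0 expf_eq0 (negbTE c0).
Qed.

Lemma fermat_pconj p : fermat p -> fermat (pconj p).
Proof.
move=> /eqP fp; rewrite fermat_point ?conj_neq0 ?hom_neq0 //.
under eq_bigr do rewrite mxE -rmorphXn.
by rewrite -rmorph_sum /= fp conjc0.
Qed.

Definition conjX (x : X) : X := exist _ (pconj (val x)) (fermat_pconj (valP x)).

Definition L : set X :=
  [set x | exists2 v : 'rV[R]_5, v != 0 &
     val x = point (map_mx (real_complex R) v)].

Lemma fermat_pdiag (d : 'rV[R[i]]_5) p : (forall j, d 0 j ^+ 5 = 1) ->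
  fermat p -> fermat (pdiag d p).
Proof.
move=> d1 fp; rewrite fermat_point; last first.
  apply: scale_row_neq0 (hom_neq0 p) => j.
  by apply/eqP => dj; have /eqP := d1 j; rewrite dj expr0n eq_sym oner_eq0.
by under eq_bigr do rewrite mxE exprMn d1 mul1r.
Qed.

Definition phase (d : 'rV[R[i]]_5) (d1 : forall j, d 0 j ^+ 5 = 1) (x : X) : X :=
  exist _ (pdiag d (val x)) (fermat_pdiag d1 (valP x)).

Definition G : set (X -> X) :=
  [set g | exists (d : 'rV[R[i]]_5) (d1 : forall j, d 0 j ^+ 5 = 1), g = phase d1].

(* Only the restriction of u0 to sector0 is relevant. *)
Definition finite_energy_strip (u0 : C -> X) : Prop :=
  [/\ continuous_onCP sector0 (val \o u0),
      holomorphic_onCP (interior sector0) (val \o u0) &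
      (energy (interior sector0) (val \o u0) < +oo)%E].

Definition strip_boundary (g : X -> X) (u0 : C -> X) : Prop :=
  forall r : R, 0 < r -> L (u0 r%:C) /\ (g @` L) (u0 (r%:C * sigma)).

Definition reflected (g : X -> X) (u0 : C -> X) (k : nat) (z : C) : X :=
  if odd k then iter k.+1 g (conjX (u0 (sigma ^+ k.+1 * conjc z)))
  else iter k g (u0 (sigma ^- k * z)).

(* u is the holomorphic extension to CP^1 of the map on C \ {0} glued from the
   pieces reflected g u0 k on sector k. *)
Definition reflection_sphere (g : X -> X) (u0 : C -> X) (u : CP R 1 -> X) : Prop :=
  holomorphic_sphere (val \o u) /\
  forall k, (k < 10)%N -> forall z, sector k z -> u (ofC z) = reflected g u0 k z.

End ComplexGeometry.

(* Main.v *)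
(* With sigma^10 = 1, g^5 = 1 and g o conj o g = conj, the reflection formula is
   10-periodic in k, so it can be used on the sector of every index k.  On
   C \ {0} both symmetries are then read off: conjugation exchanges the sectors
   k and 9 - k, and gamma = sigma^2 shifts k by 2.  They extend to 0 and to
   infinity because u is continuous and the symmetries act on the affine charts
   by continuous maps. *)
From Pilot Require Import Defs.
From mathcomp Require Import all_boot all_order all_algebra.
From mathcomp Require Import complex.
From mathcomp Require Import all_classical all_reals all_analysis.
From mathcomp Require Import ring lra.

Import Order.TTheory GRing.Theory Num.Theory.
Import numFieldNormedType.Exports.
(* [point], [proj] and [hom] are shadowed by the library imports. *)
Import Pilot.Defs.

Local Open Scope classical_set_scope.
Local Open Scope ring_scope.
Local Open Scope complex_scope.

(** * Affine charts and diagonal maps of projective space *)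

Lemma chart_dom_point (F : fieldType) (n : nat) (v : 'rV[F]_n.+1) i :
  v != 0 -> chart_dom i (point v) = (v 0 i != 0).
Proof.
move=> v0; rewrite /chart_dom; have [c c0 ->] := hom_point v0.
by rewrite mxE mulf_eq0 (negbTE c0).
Qed.

Lemma chart_point (F : fieldType) (n : nat) (v : 'rV[F]_n.+1) i j :
  v != 0 -> chart i (point v) 0 j = v 0 j / v 0 i.
Proof.
move=> v0; rewrite /chart; have [c c0 ->] := hom_point v0.
by rewrite !mxE -mulf_div divff // mul1r.
Qed.

Lemma exists_chart_dom (F : fieldType) (n : nat) (p : proj F n) :
  exists i, chart_dom i p.
Proof.
have /rV0Pn[i pi] := hom_neq0 p.
by exists i.
Qed.

Lemma chart_inj (F : fieldType) (n : nat) (p q : proj F n) i :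
  chart_dom i p -> chart_dom i q ->
  (forall j, chart i p 0 j = chart i q 0 j) -> p = q.
Proof.
move=> pi qi pq; rewrite -(homK p) -(homK q) -(pointZ (hom p) (invr_neq0 pi)).
rewrite -(pointZ (hom q) (invr_neq0 qi)); congr point; apply/rowP => j.
by have := pq j; rewrite !mxE mulrC => ->; rewrite mulrC.
Qed.

Lemma pdiag_pdiag (F : fieldType) (n : nat) (d e : 'rV[F]_n.+1) (p : proj F n) :
  (forall j, d 0 j != 0) -> (forall j, e 0 j != 0) ->
  pdiag d (pdiag e p) = pdiag (\row_j (d 0 j * e 0 j)) p.
Proof.
move=> d0 e0; rewrite {2}/pdiag pdiag_point ?scale_row_neq0 ?hom_neq0 //.
by congr point; apply/rowP => j; rewrite !mxE mulrA.
Qed.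

Lemma pdiag1 (F : fieldType) (n : nat) (p : proj F n) : pdiag (const_mx 1) p = p.
Proof.
rewrite -[RHS]homK; congr point; apply/rowP => j.
by rewrite !mxE mul1r.
Qed.

Lemma iter_pdiag (F : fieldType) (n : nat) (d : 'rV[F]_n.+1) k (p : proj F n) :
  (forall j, d 0 j != 0) -> iter k (pdiag d) p = pdiag (\row_j d 0 j ^+ k) p.
Proof.
move=> d0; have dk m j : (\row_j d 0 j ^+ m) 0 j != 0 by rewrite mxE expf_neq0.
elim: k => [|k IH].
  by rewrite -[LHS]pdiag1; congr (pdiag _ p); apply/rowP => j; rewrite !mxE.
rewrite iterS IH pdiag_pdiag //; congr (pdiag _ p).
by apply/rowP => j; rewrite !mxE exprS.
Qed.

(** * Passing to the limit at a puncture *)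

Lemma holomorphic_onCP_cvg (R : realType) (n : nat) (f : R[i]^o -> CP R n)
    (U : set R[i]^o) (z : R[i]^o) i :
  holomorphic_onCP U f -> U z -> chart_dom i (f z) ->
  (\forall w \near nbhs z, chart_dom i (f w)) /\
  forall j,
    (chart i (f w) 0 j : R[i]^o) @[w --> z] --> (chart i (f z) 0 j : R[i]^o).
Proof.
move=> fh Uz fi; have [nf df] := fh z Uz i fi; split; [exact: nf|move=> j].
by have /derivable1_diffP/differentiable_continuous := df j.
Qed.

(* Limits in projective space are unique: the two sides of the functional
   equation have the same limit at the puncture. *)
Lemma holomorphic_eq_at_puncture (R : realType) (n : nat)
    (f : R[i]^o -> CP R n) (h : CP R n -> CP R n) (m : R[i]^o -> R[i]^o)
    (phi : 'I_n.+1 -> 'I_n.+1 -> R[i]^o -> R[i]^o) :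
  holomorphic_onCP setT f -> continuous m -> m 0 = 0 ->
  (forall i p, chart_dom i p -> chart_dom i (h p)) ->
  (forall i j p, chart_dom i p -> chart i (h p) 0 j = phi i j (chart i p 0 j)) ->
  (forall i j, continuous (phi i j)) ->
  (forall z, z != 0 -> f (m z) = h (f z)) -> f 0 = h (f 0).
Proof.
move=> fh mc m0 hdom hphi phic fm.
have [i fi] := exists_chart_dom _ _ (f 0).
have [nf cf] := holomorphic_onCP_cvg _ _ _ _ _ _ fh I fi.
apply: (chart_inj _ _ _ _ i fi (hdom _ _ fi)) => j; rewrite hphi //.
(* Only [w] avoids 0. The map [m] may send nonzero points to 0, so the limit of the chart along the
   full neighbourhood filter is composed with [m]. *)
have lim1 : (chart i (f (m w)) 0 j : R[i]^o) @[w --> (0 : R[i]^o)^'] -->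
    (chart i (f 0) 0 j : R[i]^o).
  apply: cvg_trans (cf j).
  apply: (@cvg_comp _ _ _ m (fun w => chart i (f w) 0 j : R[i]^o) _
    (nbhs (0 : R[i]^o))) => //.
  apply: cvg_trans; last by have := mc 0; rewrite /continuous_at m0; apply.
  by apply: cvg_app; exact: nbhs_dnbhs.
have lim2 : (phi i j (chart i (f w) 0 j) : R[i]^o) @[w --> (0 : R[i]^o)^'] -->
    (phi i j (chart i (f 0) 0 j) : R[i]^o).
  apply: (@cvg_comp _ _ _ (fun w => chart i (f w) 0 j : R[i]^o) (phi i j) _
    (nbhs (chart i (f 0) 0 j : R[i]^o))); last exact: phic.
  apply: cvg_trans (cf j).
  by apply: cvg_app; exact: nbhs_dnbhs.
apply: (cvg_unique (@norm_hausdorff _ R[i]^o) lim1).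
apply: cvg_trans lim2; apply: near_eq_cvg.
have nz : \forall w \near (0 : R[i]^o)^', w != 0 by exact: nbhs_dnbhs_neq.
have fdom : \forall w \near (0 : R[i]^o)^', chart_dom i (f w) by exact: nbhs_dnbhs.
by near=> w; rewrite fm ?hphi //; near: w.
Unshelve. all: by end_near.
Qed.

Lemma continuous_conjc (R : realType) :
  continuous ((@conjc R) : R[i]^o -> R[i]^o).
Proof.
(* Conjugation is an isometry, so the radius [e] itself serves. *)
move=> z; apply/(@cvgrPdist_lt _ R[i]^o _ _ (nbhs_filter z)) => e e0.
apply/nbhs_ballP; exists e => //= w.
by rewrite /ball /= -rmorphB normcJ.
Qed.

(** * The unit circle, polar form and the sectors *)

Lemma expiD (R : realType) (s t : R) : expi (s + t) = expi s * expi t.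
Proof. by rewrite /expi cosD sinD; simpc; congr (_ +i* _); ring. Qed.

Lemma expiMn (R : realType) (t : R) k : expi (k%:R * t) = expi t ^+ k.
Proof.
elim: k => [|k IH]; first by rewrite mul0r /expi cos0 sin0 expr0.
by rewrite exprS -IH -expiD -natr1; congr expi; ring.
Qed.

Lemma expiN (R : realType) (t : R) : expi (- t) = conjc (expi t).
Proof. by rewrite /expi cosN sinN. Qed.

Lemma sigma10 (R : realType) : sigma R ^+ 10 = 1.
Proof.
rewrite /sigma -expiMn (_ : 10%:R * _ = pi *+ 2); last by field.
by rewrite /expi cos2pi sin2pi.
Qed.

Lemma sigma_neq0 (R : realType) : sigma R != 0.
Proof.
by apply/eqP => s0; have /eqP := sigma10 R; rewrite s0 expr0n /= eq_sym oner_eq0.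
Qed.

Lemma sigma_conj (R : realType) : conjc (sigma R) = (sigma R)^-1.
Proof.
apply: (mulfI (sigma_neq0 R)); rewrite divff ?sigma_neq0 // /sigma -expiN -expiD.
by rewrite subrr /expi cos0 sin0.
Qed.

Lemma conj_sigmaM (R : realType) k (w : R[i]) :
  conjc (sigma R ^+ k * w) = sigma R ^- k * conjc w.
Proof. by rewrite rmorphM rmorphXn -exprVn -sigma_conj. Qed.

Lemma gamma_sigma (R : realType) : gamma R = sigma R ^+ 2.
Proof. by rewrite /sigma -expiMn /gamma; congr expi; field. Qed.

Lemma gamma_neq0 (R : realType) : gamma R != 0.
Proof. by rewrite gamma_sigma expf_neq0 ?sigma_neq0. Qed.

(** The angle is taken nonnegative so that counting sectors up to it yields a natural number. *)
Lemma exists_expi (R : realType) (x y : R) : x ^+ 2 + y ^+ 2 = 1 ->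
  exists2 t, 0 <= t & x +i* y = expi t.
Proof.
move=> xy1.
have x1 : -1 <= x <= 1 by have y2 := sqr_ge0 y; apply/andP; split; nra.
have cx : cos (acos x) = x by rewrite acosK // in_itv.
have sx : sin (acos x) = `|y|.
  by rewrite sin_acos // -sqrtr_sqr; congr Num.sqrt; rewrite -xy1; ring.
have [y0|y0] := leP 0 y.
  by exists (acos x); rewrite ?acos_ge0 // /expi cx sx ger0_norm.
(* On the lower half circle the angle is [- acos x], raised by a full turn to become nonnegative. *)
exists (- acos x + pi *+ 2).
  by have := acos_lepi x1; have := pi_ge0 R; rewrite mulr2n; lra.
by rewrite /expi cosD2pi sinD2pi cosN sinN cx sx ltr0_norm // opprK.
Qed.

Lemma polar (R : realType) (z : R[i]) : z != 0 ->
  exists r t : R, [/\ 0 < r, 0 <= t & z = r%:C * expi t].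
Proof.
case: z => x y z0; set r := Num.sqrt (x ^+ 2 + y ^+ 2).
have n0 : 0 < x ^+ 2 + y ^+ 2.
  rewrite lt_neqAle addr_ge0 ?sqr_ge0 // andbT eq_sym paddr_eq0 ?sqr_ge0 //.
  by move: z0; rewrite eq_complex /= !sqrf_eq0.
have r0 : 0 < r by rewrite sqrtr_gt0.
have rr : r ^+ 2 = x ^+ 2 + y ^+ 2 by rewrite sqr_sqrtr // ltW.
have [|t t0 e] := @exists_expi R (x / r) (y / r).
  by rewrite !expr_div_n -mulrDl rr divff // gt_eqF.
exists r, t; split=> //; rewrite -e; simpc.
by congr (_ +i* _); field; rewrite gt_eqF.
Qed.

Lemma exists_sector (R : realType) (z : R[i]) : z != 0 -> exists k, sector k z.
Proof.
move=> /polar[r [t [r0 t0 ->]]]; have p0 := pi_gt0 R.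
have pn0 : pi != 0 :> R by rewrite gt_eqF.
(* Each sector has opening [pi / 5], so [k] counts the whole sectors below angle [t]; rotating back
   by [k] of them lands in [sector0]. *)
have [k /andP[k1 k2]] : exists k, k%:R <= t * 5 / pi < k.+1%:R.
  exists (Num.truncn (t * 5 / pi)).
  by rewrite truncn_itv // divr_ge0 ?mulr_ge0 // ltW.
exists k, (r%:C * expi (t - k%:R * (2 * pi / 10))); last first.
  by rewrite mulrCA -expiMn -expiD; congr (_ * expi _); ring.
exists r, (t * 5 / pi - k%:R); split=> //.
  by move: k2; rewrite -natr1 => k2; apply/andP; split; lra.
by congr (_ * expi _); move: pn0; generalize (@pi R) => p pn0; field.
Qed.

Lemma sector_mod10 (R : realType) k (z : R[i]) : sector (k %% 10) z = sector k z.
Proof.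
by rewrite /sector {2}(divn_eq k 10) exprD mulnC exprM sigma10 expr1n mul1r.
Qed.

(** This is the reflection across the bisector of the sector: it exchanges the two boundary rays and
    acts on the strip coordinate by [t] to [1 - t]. *)
Lemma sector0_reflect (R : realType) (w : R[i]) :
  sector0 w -> sector0 (sigma R * conjc w).
Proof.
move=> [r [t [r0 t01 ->]]]; exists r, (1 - t); split=> //; first by lra.
have -> : conjc (r%:C * expi (pi * t / 5)) = r%:C * expi (- (pi * t / 5)).
  by rewrite expiN rmorphM /= oppr0.
rewrite mulrCA -expiD.
by congr (_ * expi _); field.
Qed.

(** * Relations between [G] and complex conjugation *)

Lemma phase_neq0 (R : realType) (d : 'rV[R[i]]_5) :
  (forall j, d 0 j ^+ 5 = 1) -> forall j, d 0 j != 0.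
Proof.
move=> d1 j; apply/eqP => dj; have /eqP := d1 j.
by rewrite dj expr0n eq_sym oner_eq0.
Qed.

Lemma val_iter_phase (R : realType) (d : 'rV[R[i]]_5)
    (d1 : forall j, d 0 j ^+ 5 = 1) n (x : X R) :
  val (iter n (phase d1) x) = pdiag (\row_j d 0 j ^+ n) (val x).
Proof.
rewrite -iter_pdiag; last exact: phase_neq0.
by elim: n => [//|n IH]; rewrite !iterS -[RHS]/(pdiag d (iter n _ _)) -IH.
Qed.

Lemma iter_G_mul5 (R : realType) (g : X R -> X R) n :
  G g -> iter (n * 5) g =1 id.
Proof.
move=> [d [d1 ->]] x; rewrite iterM.
have g5 y : iter 5 (phase d1) y = y.
  apply: val_inj; rewrite val_iter_phase -[RHS]pdiag1.
  by congr (pdiag _ (val y)); apply/rowP => j; rewrite !mxE d1.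
by elim: n => // n IH; rewrite iterS IH g5.
Qed.

Lemma pconjK (R : realType) (n : nat) : involutive (@pconj R n).
Proof.
move=> p; rewrite {2}/pconj pconj_point ?conj_neq0 ?hom_neq0 // -[RHS]homK.
by congr point; apply/rowP => j; rewrite !mxE conjcK.
Qed.

Lemma conjXK (R : realType) : involutive (@conjX R).
Proof. by move=> x; apply: val_inj; exact: pconjK. Qed.

(** Conjugation turns the inner factors into their conjugates, which are their inverses and cancel
    the outer ones. *)
Lemma pdiag_pconj_pdiag (R : realType) (n : nat) (d : 'rV[R[i]]_n.+1)
    (p : CP R n) :
  (forall j, d 0 j * conjc (d 0 j) = 1) -> pdiag d (pconj (pdiag d p)) = pconj p.
Proof.
move=> d1; have d0 j : d 0 j != 0.
  by apply/eqP => dj; have /eqP := d1 j; rewrite dj mul0r eq_sym oner_eq0.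
have p0 := hom_neq0 p; have q0 := scale_row_neq0 d0 p0.
rewrite {2}/pdiag (pconj_point q0) (pdiag_point d0 (conj_neq0 q0)).
by congr point; apply/rowP => j; rewrite !mxE rmorphM mulrA d1 mul1r.
Qed.

Lemma conjX_G (R : realType) (g : X R -> X R) x :
  G g -> g (conjX (g x)) = conjX x.
Proof.
move=> [d [d1 ->]]; apply: val_inj; apply: pdiag_pconj_pdiag => j.
(* A nonnegative number whose fifth power is 1 equals 1, so roots of unity have modulus 1. *)
have /eqP dj : `|d 0 j| == 1 by rewrite -(@pexpr_eq1 _ _ 5) // -normrX d1 normr1.
by rewrite -sqr_normc dj expr1n.
Qed.

Lemma iter_conjX_G (R : realType) (g : X R -> X R) n x :
  G g -> iter n g (conjX (iter n g x)) = conjX x.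
Proof.
by move=> hg; elim: n x => // n IH x; rewrite iterSr /= conjX_G // IH.
Qed.

(** Conjugation inverts [g]. The inverse is written as the ninth iterate, so that exponents stay
    natural and match the index [k * 9 + 9] of the conjugate sector. *)
Lemma conjX_iter_G (R : realType) (g : X R -> X R) n x :
  G g -> conjX (iter n g x) = iter (n * 9) g (conjX x).
Proof.
move=> hg; rewrite -(iter_conjX_G _ _ n x hg) -iterD -mulnSr.
by rewrite (_ : n * 10 = n * 2 * 5)%N ?iter_G_mul5 // -mulnA.
Qed.

(** * The symmetries away from 0 and infinity *)

(** In the coordinate [w] on the model sector, the formula depends on [k] only through its parity
    and the power of [g]. *)
Lemma reflectedE (R : realType) (g : X R -> X R) (u0 : R[i]^o -> X R) k w :
  reflected g u0 k (sigma R ^+ k * w) =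
  if odd k then iter k.+1 g (conjX (u0 (sigma R * conjc w)))
  else iter k g (u0 w).
Proof.
have sk : sigma R ^+ k != 0 by rewrite expf_neq0 ?sigma_neq0.
rewrite /reflected; case: ifP => _; congr (iter _ _ _).
  by rewrite conj_sigmaM exprS -mulrA (mulrA (_ ^+ k)) divff // mul1r.
by rewrite mulrA mulVf // mul1r.
Qed.

Lemma reflection_sphere_sector (R : realType) (g : X R -> X R)
    (u0 : R[i]^o -> X R) (u : CP R 1 -> X R) k z :
  G g -> reflection_sphere g u0 u -> sector k z ->
  u (ofC z) = reflected g u0 k z.
Proof.
move=> hg [_ hu] kz.
rewrite (hu (k %% 10)%N) ?ltn_mod // ?sector_mod10 //.
case: kz => w _ <-; rewrite reflectedE.
have -> : sigma R ^+ k = sigma R ^+ (k %% 10).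
  by rewrite {1}(divn_eq k 10) exprD mulnC exprM sigma10 expr1n mul1r.
(* The exponents are [k.+1] in the odd branch and [k] in the even one, hence the offset [n], used at
   1 and 0. *)
have iter_mod10 n x : iter (n + k %% 10) g x = iter (n + k) g x.
  rewrite -[LHS](iter_G_mul5 _ _ (k %/ 10 * 2) hg) -iterD.
  by rewrite -mulnA addnCA -divn_eq.
rewrite reflectedE odd_mod //; case: ifP => _; first exact: (iter_mod10 1).
exact: (iter_mod10 0).
Qed.

Lemma reflection_sphere_conj (R : realType) (g : X R -> X R)
    (u0 : R[i]^o -> X R) (u : CP R 1 -> X R) (z : R[i]) :
  G g -> reflection_sphere g u0 u -> z != 0 ->
  u (ofC (conjc z)) = conjX (u (ofC z)).
Proof.
move=> hg hu /exists_sector[k kz].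
have hk := reflection_sphere_sector _ _ _ _ _ _ hg hu.
rewrite (hk _ _ kz); case: kz => w w0 <-; rewrite reflectedE.
(* The index [k * 9 + 9] is [9 - k] modulo 10, written without subtraction because [k] is
   unbounded. *)
have -> : conjc (sigma R ^+ k * w) = sigma R ^+ (k * 9 + 9) * (sigma R * conjc w).
  rewrite conj_sigmaM mulrA -exprSr; congr (_ * _).
  have sk : sigma R ^+ k != 0 by rewrite expf_neq0 ?sigma_neq0.
  apply: (mulfI sk); rewrite divff // -exprD.
  by rewrite (_ : (k + _)%N = (10 * k.+1)%N) ?exprM ?sigma10 ?expr1n //; ring.
rewrite (hk (k * 9 + 9)%N); last first.
  by exists (sigma R * conjc w) => //; exact: sector0_reflect.
have sw : sigma R * conjc (sigma R * conjc w) = w.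
  rewrite -{2}[sigma R]expr1 conj_sigmaM conjcK expr1 mulrA.
  by rewrite divff ?mul1r ?sigma_neq0.
(* The two indices have opposite parity, so exactly one side uses the conjugated branch. For even
   [k] the powers of [g] differ by 10, for odd [k] they agree. *)
rewrite reflectedE sw oddD oddM andbT addbT; case: ifP => [ok|/negbFE ok].
  rewrite (negbTE ok) conjX_iter_G // -addnS iterD.
  by rewrite (iter_G_mul5 _ _ 2).
by rewrite ok conjX_iter_G // conjXK mulSn addnC.
Qed.

(** A shift of the index by 2 keeps its parity and the coordinate [w], so either branch gains just
    two factors [g]. *)
Lemma reflection_sphere_gamma (R : realType) (g : X R -> X R)
    (u0 : R[i]^o -> X R) (u : CP R 1 -> X R) (z : R[i]) :
  G g -> reflection_sphere g u0 u -> z != 0 ->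
  u (ofC (gamma R * z)) = iter 2 g (u (ofC z)).
Proof.
move=> hg hu /exists_sector[k kz].
have hk := reflection_sphere_sector _ _ _ _ _ _ hg hu.
rewrite (hk _ _ kz); case: kz => w w0 <-; rewrite reflectedE.
rewrite gamma_sigma mulrA -exprD (hk (2 + k)%N); last by exists w.
by rewrite reflectedE oddD /=; case: ifP.
Qed.

(** * Extending the symmetries across a puncture *)

Lemma chart_dom_pconj (R : realType) (n : nat) (p : CP R n) i :
  chart_dom i p -> chart_dom i (pconj p).
Proof.
by move=> pi; rewrite chart_dom_point ?conj_neq0 ?hom_neq0 // mxE fmorph_eq0.
Qed.

Lemma chart_pconj (R : realType) (n : nat) (p : CP R n) i j :
  chart i (pconj p) 0 j = conjc (chart i p 0 j).
Proof. by rewrite chart_point ?conj_neq0 ?hom_neq0 // !mxE fmorph_div. Qed.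

Lemma chart_dom_pdiag (F : fieldType) (n : nat) (d : 'rV[F]_n.+1)
    (p : proj F n) i :
  (forall j, d 0 j != 0) -> chart_dom i p -> chart_dom i (pdiag d p).
Proof.
move=> d0 pi; rewrite chart_dom_point ?scale_row_neq0 ?hom_neq0 // mxE.
by rewrite mulf_neq0.
Qed.

Lemma chart_pdiag (F : fieldType) (n : nat) (d : 'rV[F]_n.+1)
    (p : proj F n) i j :
  (forall j, d 0 j != 0) ->
  chart i (pdiag d p) 0 j = d 0 j / d 0 i * chart i p 0 j.
Proof.
by move=> d0; rewrite chart_point ?scale_row_neq0 ?hom_neq0 // !mxE mulf_div.
Qed.

Lemma holomorphic_conj_at0 (R : realType) (n : nat) (f : R[i]^o -> CP R n) :
  holomorphic_onCP setT f -> (forall z, z != 0 -> f (conjc z) = pconj (f z)) ->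
  f 0 = pconj (f 0).
Proof.
move=> fh fc.
apply: (@holomorphic_eq_at_puncture R n f _ (@conjc R) (fun _ _ => @conjc R)) => //.
- exact: continuous_conjc.
- by rewrite conjc0.
- by move=> i p; exact: chart_dom_pconj.
- by move=> i j p _; exact: chart_pconj.
- by move=> _ _; exact: continuous_conjc.
Qed.

(** The factor [a] is left free: it becomes [gamma R] at 0 and its inverse at infinity. *)
Lemma holomorphic_pdiag_at0 (R : realType) (n : nat) (f : R[i]^o -> CP R n)
    (a : R[i]) (d : 'rV[R[i]]_n.+1) :
  holomorphic_onCP setT f -> (forall j, d 0 j != 0) ->
  (forall z, z != 0 -> f (a * z) = pdiag d (f z)) -> f 0 = pdiag d (f 0).
Proof.
move=> fh d0 fd.
apply: (@holomorphic_eq_at_puncture R n f _ (fun z => a * z)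
  (fun i j c => d 0 j / d 0 i * c)) => //.
- exact: mulrl_continuous.
- by rewrite mulr0.
- by move=> i p; exact: chart_dom_pdiag.
- by move=> i j p _; exact: chart_pdiag.
- by move=> i j; exact: mulrl_continuous.
Qed.

(** * Points of the projective line in its two charts *)

Lemma row2E (R : realType) (v : 'rV[R[i]]_2) : v = row2 (v 0 0) (v 0 1).
Proof.
apply/rowP => j; rewrite mxE; case: eqP => [->//|/eqP j0].
by congr (v 0 _); apply: val_inj; case: j j0 => [[|[|]]].
Qed.

Lemma scale_row2 (R : realType) (c a b : R[i]) :
  c *: row2 a b = row2 (c * a) (c * b).
Proof. by apply/rowP => j; rewrite !mxE; case: ifP. Qed.

Lemma ofC_infE (R : realType) (w : R[i]) : w != 0 -> ofC_inf w = ofC w^-1.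
Proof.
move=> w0; rewrite /ofC -(pointZ (row2 _ 1) w0) scale_row2 divff //.
by rewrite mulr1.
Qed.

Lemma CP1_cases (R : realType) (p : CP R 1) :
  p = infty R \/ exists z, p = ofC z.
Proof.
rewrite -(homK p); move: (hom p) (hom_neq0 p) => v.
rewrite (row2E _ v); move: (v 0 0) (v 0 1) => a b v0.
have [b0|b0] := eqVneq b 0; [left|right].
  have a0 : a != 0.
    apply: contraNneq v0 => a0; apply/eqP/rowP => j.
    by rewrite !mxE a0 b0; case: ifP.
  by rewrite /infty -(pointZ (row2 1 0) a0) scale_row2 mulr1 mulr0 b0.
exists (a / b).
by rewrite /ofC -(pointZ (row2 _ 1) b0) scale_row2 mulr1 mulrC divfK.
Qed.

Theorem lemma11p1 (R : realType) (g : X R -> X R) (hg : G g)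
    (u0 : R[i]%C -> X R)
    (hstrip : finite_energy_strip u0) (hbd : strip_boundary g u0)
    (u : CP R 1 -> X R) (hu : reflection_sphere g u0 u) :
  (forall z : CP R 1, u z = conjX (u (pconj z))) /\
  (forall z : CP R 1, u (cmul (gamma R) z) = iter 2 g (u z)).
Proof.
have [[h0 hinf] _] := hu.
have uconj z : z != 0 -> u (ofC (conjc z)) = conjX (u (ofC z)).
  exact: (reflection_sphere_conj _ _ _ _ _ hg hu).
have ugamma z : z != 0 -> u (ofC (gamma R * z)) = iter 2 g (u (ofC z)).
  exact: (reflection_sphere_gamma _ _ _ _ _ hg hu).
split=> z.
  have [->|[{}z ->]] := CP1_cases _ z.
    rewrite pconj_infty; apply: val_inj.
    (* By definition [infty] is [ofC_inf 0], and conjugation commutes with the chart change [w] to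
       [w^-1]. *)
    apply: (holomorphic_conj_at0 _ _ _ hinf) => w w0 /=.
    by rewrite !ofC_infE ?fmorph_eq0 // -fmorphV uconj ?invr_eq0.
  rewrite pconj_ofC; have [->|z0] := eqVneq z 0; last first.
    by rewrite uconj // conjXK.
  rewrite conjc0; apply: val_inj.
  by apply: (holomorphic_conj_at0 _ _ _ h0) => w w0 /=; rewrite uconj.
(* The square of [g] is again diagonal, so the extension result for [pdiag] applies with [d2]. *)
have [d [d1 gd]] := hg; set d2 := (\row_j d 0 j ^+ 2 : 'rV_5).
have val_g2 x : val (iter 2 g x) = pdiag d2 (val x).
  by rewrite gd val_iter_phase.
have d20 j : d2 0 j != 0 by rewrite mxE expf_neq0 ?phase_neq0.
have [->|[{}z ->]] := CP1_cases _ z.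
  rewrite cmul_infty ?gamma_neq0 //; apply: val_inj; rewrite val_g2.
  (* In the coordinate at infinity, multiplication by [gamma R] becomes multiplication by its
     inverse. *)
  apply: (holomorphic_pdiag_at0 _ _ _ (gamma R)^-1 _ hinf d20) => w w0 /=.
  rewrite !ofC_infE ?mulf_neq0 ?invr_eq0 ?gamma_neq0 // invfM invrK.
  by rewrite ugamma ?invr_eq0 // val_g2.
rewrite cmul_ofC ?gamma_neq0 //; have [->|z0] := eqVneq z 0; last exact: ugamma.
rewrite mulr0; apply: val_inj; rewrite val_g2.
apply: (holomorphic_pdiag_at0 _ _ _ (gamma R) _ h0 d20) => w w0 /=.
by rewrite ugamma // val_g2.
Qed.
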